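(* Let $T$ be a tree with $n=n(T)>3$ vertices and ${\rm diam}(T)\geq\frac{2n}{3}$. Then $W(T)<E_1(T)$.
   Context: $\varepsilon_T(v)=\max_u d_T(v,u)$ is the eccentricity, ${\rm diam}(T)=\max_v\varepsilon_T(v)$, $E_1(T)=\sum_{v\in V(T)}\varepsilon_T(v)^2$, and $W(T)=\sum_{\{u,v\}\subseteq V(T)}d_T(u,v)$ is the Wiener index. *)

(* Defs.v *)
From mathcomp Require Import all_boot all_order all_algebra.

Set Implicit Arguments.
Unset Strict Implicit.
Unset Printing Implicit Defensive.

Section GraphInvariants.

Variables (T : finType) (e : rel T).

Definition simple_graph : Prop := symmetric e /\ irreflexive e.

(* By [ucycle], [c] lists pairwise distinct vertices; a single vertex and the
   two ends of one edge also form a [ucycle], hence the bound on [size c]. *)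
Definition acyclic : Prop := forall c : seq T, ucycle e c -> size c < 3.

Definition is_tree : Prop :=
  [/\ simple_graph, 0 < #|T|, forall x y : T, connect e x y & acyclic].

Definition has_walk (k : nat) (x y : T) : bool :=
  [exists p : k.-tuple T, path e x p && (last x p == y)].

(* Shortest walks repeat no vertex, so lengths below [#|T|] suffice; the
   default [#|T|] is only taken by pairs that are not connected. *)
Definition dist (x y : T) : nat :=
  \big[minn/#|T|]_(k < #|T| | has_walk k x y) k.

Definition ecc (v : T) : nat := \max_(u : T) dist v u.

Definition diam : nat := \max_(v : T) ecc v.

Definition E1 : nat := \sum_(v : T) ecc v ^ 2.

(* [enum_rank] only serves to count each unordered pair of distinct vertices
   once. *)
Definition wiener : nat :=
  \sum_(p : T * T | enum_rank p.1 < enum_rank p.2) dist p.1 p.2.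

Lemma has_walkP k x y :
  reflect (exists p : seq T, [/\ size p = k, path e x p & last x p = y])
          (has_walk k x y).
Proof.
apply: (iffP existsP) => [[p /andP[xp /eqP lp]]|[p [sp xp lp]]].
  by exists p; rewrite size_tuple.
have sp' : size p == k by rewrite sp.
by exists (Tuple sp') => /=; rewrite xp lp eqxx.
Qed.

Lemma dist_le x (p : seq T) : path e x p -> dist x (last x p) <= size p.
Proof.
move=> /shortenP[q xq uq sub_q].
have sq : size q < #|T| by have := max_card (mem (x :: q)); rewrite (card_uniqP uq).
have hq : has_walk (Ordinal sq) x (last x q) by apply/has_walkP; exists q.
apply: (@leq_trans (size q)).
  by apply: (@Order.TotalTheory.bigmin_le_cond _ nat _ _ (Ordinal sq)
    [pred k : 'I_#|T| | has_walk k x (last x q)] (@nat_of_ord _)).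
by have [_ uq'] := andP uq; exact: uniq_leq_size.
Qed.

Lemma dist_walk x y : connect e x y ->
  exists p : seq T, [/\ size p = dist x y, path e x p & last x p = y].
Proof.
move=> /connectP[p xp ->]; case/shortenP: xp => q xq uq _.
have sq : size q < #|T| by have := max_card (mem (x :: q)); rewrite (card_uniqP uq).
set y' := last x q.
have dist_lt : dist x y' < #|T| by apply: leq_ltn_trans sq; exact: dist_le.
apply/has_walkP; move: dist_lt; rewrite /dist.
elim/big_ind: _ => [|a b Ha Hb|i hi _ //]; first by rewrite ltnn.
by rewrite /minn; case: ifP.
Qed.

End GraphInvariants.

(* Main.v *)
Require Import Defs.
From mathcomp Require Import all_boot all_order all_algebra.
From mathcomp Require Import zify lra.

(** Let [D] be the diameter and [m] the number of vertices off a diametral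
geodesic [f 0, ..., f D], so that [2 m <= D].  Both invariants are compared
through [2 W = \sum_x \sum_y d(x, y)], split along the geodesic.  Pairs on it
contribute [D (D + 1) (D + 2) / 3], while its eccentricities are at least
[max (i, D - i)], which gives about [7 D^3 / 12] to [E1].  A vertex [u] off the
geodesic has [D <= 2 ecc u], and [d(u, f i)] is at most each of [ecc u + i],
[ecc u + D - i] and [D]; summing over [i] yields at most
[(ecc u)^2 + (D^2 + D) / 2].  The pairs off the geodesic contribute at most
[m^2 D].  Up to lower order terms this bounds [W] by
[D^3 / 6 + D^3 / 4 + D^3 / 8 = 13 D^3 / 24] plus the off-geodesic part of [E1],
and [13 / 24 < 7 / 12]. *)

Section Sums.

Lemma sum_subn N r : r <= N -> 2 * \sum_(i < N) (r - i) = r * r.+1.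
Proof.
elim: N r => [|N IHN] [|r] // le_rN; first by rewrite big_ord0.
  by rewrite big1.
rewrite big_ord_recl /= subn0 (eq_bigr (fun i : 'I_N => r - i)) //.
by rewrite mulnDr IHN //; lia.
Qed.

(** Subtraction truncates, so the summand is [|i - j|]. Its two halves have equal sums after
    exchanging the indices, and row [i] of the first half gives the triangular number
    [i * i.+1 / 2]. *)
Lemma sum_distn N :
  3 * \sum_(i < N.+1) \sum_(j < N.+1) ((i - j) + (j - i)) = N * N.+1 * N.+2.
Proof.
have -> : \sum_(i < N.+1) \sum_(j < N.+1) ((i - j) + (j - i))
  = \sum_(i < N.+1) i * i.+1.
  under eq_bigr do rewrite big_split.
  rewrite big_split /= [X in _ + X]exchange_big /= addnn -mul2n big_distrr /=.
  by apply: eq_bigr => i _; rewrite sum_subn // ltnW.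
elim: N => [|N IHN]; first by rewrite big_ord_recr big_ord0.
by rewrite big_ord_recr mulnDr IHN /=; nia.
Qed.

(* The shift [c] makes the induction on [D] in steps of 2 go through: removing
   both end terms turns [(c, D + 2)] into [(c + 1, D)].  The bound is an
   equality for even [D]. *)
Lemma sum_sqr_maxn c D :
  12 * c ^ 2 * D.+1 + 6 * c * (3 * D ^ 2 + 4 * D)
    + (7 * D ^ 3 + 12 * D ^ 2 + 2 * D)
  <= 12 * \sum_(i < D.+1) (c + maxn i (D - i)) ^ 2.
Proof.
have [k] := ubnP D; elim: k D c => // k IHk [|[|D]] c ltDk.
- by rewrite big_ord_recl big_ord0 /=; nia.
- by rewrite !big_ord_recl big_ord0 /=; nia.
rewrite big_ord_recl big_ord_recr /=.
rewrite (eq_bigr (fun i : 'I_D.+1 => (c.+1 + maxn i (D - i)) ^ 2)); last first.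
  by move=> i _; rewrite /bump /=; congr (_ ^ 2); have := ltn_ord i; lia.
have ltD : D < k by lia.
have := IHk D c.+1 ltD; set S := \sum_(i < _) _.
rewrite /bump /= max0n subn0 add1n subnn maxn0.
by rewrite !expnS !expn0; nia.
Qed.

End Sums.

Section Metric.

Variables (T : finType) (e : rel T).
Hypotheses (sym_e : symmetric e) (conn_e : forall x y, connect e x y).

Local Notation d := (dist e).

Lemma dist_refl x : d x x = 0.
Proof. by have := @dist_le _ e x [::] isT; rewrite leqn0 => /eqP. Qed.

Lemma dist_triangle y x z : d x z <= d x y + d y z.
Proof.
have [p [<- xp <-]] := dist_walk (conn_e x y).
have [q [<- yq <-]] := dist_walk (conn_e (last x p) z).
by rewrite -size_cat -last_cat dist_le // cat_path xp.
Qed.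

Lemma dist_sym x y : d x y = d y x.
Proof.
have le_dist u v : d u v <= d v u.
  have [p [<- vp <-]] := dist_walk (conn_e v u).
  have := @dist_le _ e (last v p) (rev (belast v p)).
  rewrite size_rev size_belast rev_path (eq_path (e' := e)); last first.
    by move=> ? ?; rewrite sym_e.
  move=> /(_ vp); congr (d _ _ <= _).
  by case: p {vp} => //= w p; rewrite rev_cons last_rcons.
by apply/eqP; rewrite eqn_leq !le_dist.
Qed.

Lemma dist_le_ecc x y : d x y <= ecc e x.
Proof. exact: (leq_bigmax (F := fun u => d x u)). Qed.

Lemma ecc_le_diam x : ecc e x <= diam e.
Proof. exact: (leq_bigmax (F := ecc e)). Qed.

Lemma dist_le_diam x y : d x y <= diam e.
Proof. exact: leq_trans (dist_le_ecc x y) (ecc_le_diam x). Qed.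

Lemma diam_attained : 0 < #|T| -> exists x y, d x y = diam e.
Proof.
move=> T_gt0; rewrite /diam.
have [x ->] := eq_bigmax (ecc e) T_gt0.
by rewrite /ecc; have [y ->] := eq_bigmax (d x) T_gt0; exists x, y.
Qed.

(** Ordered pairs split into increasing, decreasing and diagonal ones by [enum_rank]; swapping
    coordinates matches the first two classes, and the diagonal contributes 0. *)
Lemma wiener_double : 2 * wiener e = \sum_x \sum_y d x y.
Proof.
rewrite pair_big /= (bigID (fun p => enum_rank p.1 < enum_rank p.2)) /=.
rewrite [X in _ + X](bigID (fun p => enum_rank p.2 < enum_rank p.1)) /=.
rewrite [X in _ + (_ + X)]big1 => [|[x y] /=]; last first.
  rewrite -!leqNgt andbC -eqn_leq => /eqP/ord_inj/enum_rank_inj ->.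
  exact: dist_refl.
rewrite addn0 mul2n -addnn; congr (_ + _).
rewrite /wiener (reindex_inj (h := fun p => (p.2, p.1))) /=; last first.
  by move=> [? ?] [? ?] [-> ->].
apply: eq_big => [p|p _]; last exact: dist_sym.
by case: ltngtP.
Qed.

(** The vertices of a shortest walk serve as [f]. Upper bounds are enough here: the distance between
    the ends later forces equality. *)
Lemma dist_geodesic_exists x y : exists f : nat -> T,
  [/\ f 0 = x, f (d x y) = y
    & forall i j, i <= j <= d x y -> d (f i) (f j) <= j - i].
Proof.
have [p [sp xp lp]] := dist_walk (conn_e x y).
exists (nth x (x :: p)); split=> //; first by rewrite -sp nth_last.
move=> i j /andP[le_ij]; rewrite -sp => le_jp.
elim: j le_ij le_jp => [|j IHj].
  by rewrite leqn0 => /eqP -> _; rewrite dist_refl.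
rewrite leq_eqVlt ltnS => /orP[/eqP -> _|le_ij lt_jp].
  by rewrite dist_refl.
rewrite subSn // -(addn1 (j - i)).
apply: leq_trans (dist_triangle (nth x (x :: p) j) _ _) _.
rewrite leq_add ?IHj ?(ltnW lt_jp) //.
have e_j : e (nth x (x :: p) j) (nth x p j) by exact: (pathP x xp).
by have := @dist_le _ e (nth x (x :: p) j) [:: nth x p j]; rewrite /= e_j; apply.
Qed.

Section Geodesic.

Variable f : nat -> T.
Local Notation D := (diam e).
Hypotheses (dist_ends : d (f 0) (f D) = D)
  (dist_f_le : forall i j, i <= j <= D -> d (f i) (f j) <= j - i).

Lemma dist_geodesic i j : i <= D -> j <= D ->
  d (f i) (f j) <= (i - j) + (j - i).
Proof.
move=> iD jD; case: (leqP i j) => ij.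
  by rewrite (leq_trans (dist_f_le _ _ _)) ?ij ?leq_addl.
by rewrite dist_sym (leq_trans (dist_f_le _ _ _)) ?(ltnW ij) ?leq_addr.
Qed.

(** The bounds [i] and [D - i] on the two pieces add up to [D], the distance between the ends, so
    both are tight. *)
Lemma dist_geodesic0 i : i <= D -> d (f 0) (f i) = i.
Proof.
move=> iD; have := dist_triangle (f i) (f 0) (f D).
have := @dist_f_le 0 i; have := @dist_f_le i D.
by rewrite dist_ends iD leqnn => /(_ isT) ? /(_ isT) ?; lia.
Qed.

Lemma geodesic_inj : injective (fun i : 'I_D.+1 => f i).
Proof.
move=> i j eq_ij; apply: ord_inj.
by rewrite -(@dist_geodesic0 i) -1?(@dist_geodesic0 j) ?eq_ij // -ltnS.
Qed.

Lemma ecc_geodesic i : i <= D -> maxn i (D - i) <= ecc e (f i).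
Proof.
move=> iD; have := dist_geodesic0 i iD; rewrite dist_sym => di.
have := dist_le_ecc (f i) (f 0); have := dist_le_ecc (f i) (f D).
have := dist_triangle (f i) (f 0) (f D).
by rewrite dist_ends dist_geodesic0 // di; lia.
Qed.

Lemma sum_dist_geodesic u :
  2 * \sum_(i < D.+1) d u (f i) <= 2 * ecc e u ^ 2 + D * D.+1.
Proof.
set E := ecc e u; pose r := D - E.
have le_ED : E <= D := ecc_le_diam u.
have d0 : d u (f 0) <= E := dist_le_ecc u (f 0).
have dD : d u (f D) <= E := dist_le_ecc u (f D).
have le_D2E : D <= 2 * E.
  by have := dist_triangle u (f 0) (f D); rewrite dist_ends (dist_sym (f 0)); lia.
(* The truncated terms measure how far [E + i] and [E + (D - i)] fall below [D]. As [2 * r <= D], at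
   most one of them is nonzero for each [i], so their sum can be added to the distance without
   exceeding [D]. *)
have : \sum_(i < D.+1) (d u (f i) + ((r - i) + (r - (D - i))))
    <= \sum_(i < D.+1) D.
  apply: leq_sum => i _; have iD : i <= D by rewrite -ltnS.
  have := dist_triangle (f 0) u (f i); rewrite dist_geodesic0 //.
  have := dist_triangle (f D) u (f i).
  have := dist_geodesic D i (leqnn _) iD; have := dist_le_diam u (f i).
  by rewrite /r; lia.
rewrite !big_split /= sum_nat_const card_ord.
rewrite [X in _ + (_ + X) <= _ -> _](reindex_inj rev_ord_inj) /=.
rewrite [X in _ + (_ + X) <= _ -> _](eq_bigr (fun i : 'I_D.+1 => r - i)); last first.
  by move=> i _; have := ltn_ord i; lia.
have := @sum_subn D.+1 r; set S := \sum_(i < _) (r - i).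
rewrite leqW ?leq_subr // => /(_ isT) S_eq le_S.
(* Each deficit sum is [r * r.+1 / 2]. Substituting [D = r + E] and [x = E - r], the claim reduces
   to [x <= x * x]. *)
have [x Ex] : exists x, 2 * E = D + x by exists (2 * E - D); lia.
have x_sq : x <= x * x by nia.
have rE : D = r + E by rewrite /r; lia.
move: S_eq le_S; rewrite !expnS expn0; nia.
Qed.

Lemma sum_geodesicE (F : T -> nat) (P := [set f i | i : 'I_D.+1]) :
  \sum_x F x = \sum_(i < D.+1) F (f i) + \sum_(x in ~: P) F x.
Proof.
rewrite (bigID (mem P)) /= big_imset /=; last first.
  by move=> i j _ _; exact: geodesic_inj.
by congr (_ + _); apply: eq_bigl => x; rewrite inE.
Qed.

End Geodesic.

Lemma wiener_lt_E1 : 0 < diam e -> 2 * #|T| <= 3 * diam e -> wiener e < E1 e.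
Proof.
move=> D_gt0 le_nD.
have T_gt0 : 0 < #|T|.
  rewrite lt0n; apply: contraTneq D_gt0 => T0.
  by rewrite /diam big1 // => v; have := fintype0 v.
have [x [y xyD]] := diam_attained T_gt0.
have [f [f0 fD f_le]] := dist_geodesic_exists x y.
move: f0 fD f_le; rewrite xyD => f0 fD f_le.
have fends : d (f 0) (f (diam e)) = diam e by rewrite f0 fD.
set D := diam e in D_gt0 le_nD f_le fends fD.
have splitE := sum_geodesicE f fends f_le.
set P := [set f i | i : 'I_(diam e).+1] in splitE.
set m := #|~: P|.
have card_T : #|T| = D.+1 + m.
  by rewrite -(cardsC P) card_imset ?card_ord //; exact: geodesic_inj.
have le_A : 3 * \sum_(i < D.+1) \sum_(j < D.+1) d (f i) (f j)
    <= D * D.+1 * D.+2.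
  rewrite -sum_distn leq_mul2l /=; apply: leq_sum => i _; apply: leq_sum => j _.
  by apply: dist_geodesic; rewrite // -ltnS.
have le_B : 2 * \sum_(u in ~: P) \sum_(i < D.+1) d u (f i)
    <= 2 * \sum_(u in ~: P) ecc e u ^ 2 + m * (D * D.+1).
  rewrite !big_distrr -sum_nat_const -big_split /=; apply: leq_sum => u _.
  exact: sum_dist_geodesic.
have le_C : \sum_(u in ~: P) \sum_(v in ~: P) d u v <= m * (m * D).
  rewrite -!sum_nat_const; apply: leq_sum => u _; apply: leq_sum => v _.
  exact: dist_le_diam.
have le_EP : 7 * D ^ 3 + 12 * D ^ 2 + 2 * D
    <= 12 * \sum_(i < D.+1) ecc e (f i) ^ 2.
  apply: leq_trans (_ : 12 * \sum_(i < D.+1) (maxn i (D - i)) ^ 2 <= _).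
    exact: (sum_sqr_maxn 0).
  rewrite leq_mul2l /=; apply: leq_sum => i _.
  by rewrite leq_exp2r // ecc_geodesic // -ltnS.
have E1E : E1 e = _ := splitE _.
have := wiener_double.
rewrite (eq_bigr _ (fun u _ => splitE (d u))) splitE !big_split /=.
(* By symmetry of the distance the two mixed blocks coincide, so twice the Wiener index is
   [A + 2 * B + C]. *)
rewrite [X in _ + X + _]exchange_big /=.
have -> : \sum_(u in ~: P) \sum_(i < D.+1) d (f i) u
    = \sum_(u in ~: P) \sum_(i < D.+1) d u (f i).
  by apply: eq_bigr => u _; apply: eq_bigr => i _; exact: dist_sym.
move: le_A le_B le_C le_EP E1E; rewrite -/D.
set A := \sum_(i < _) _; set B := \sum_(u in _) _.
set EO := \sum_(u in _) _; set C := \sum_(u in _) _.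
set EP := \sum_(i < _) _ => le_A le_B le_C le_EP -> W2.
have le_mD : 2 * m <= D by lia.
have le_m1 : 2 * (m * (D * D.+1)) <= D * (D * D.+1).
  by rewrite mulnA leq_mul2r le_mD orbT.
have le_m2 : 4 * (m * (m * D)) <= D * D * D.
  by have := leq_mul (leq_mul le_mD le_mD) (leqnn D); lia.
(* The collected bounds give [24 * (E1 - W) >= D^3 + 6 * D^2 - 4 * D], which is positive because
   [D >= 1]. *)
have := leq_mul D_gt0 D_gt0; rewrite mul1n.
move: le_A le_EP le_m1 le_m2; rewrite !expnS expn0; nia.
Qed.

End Metric.

Theorem theorem3p2 (T : finType) (e : rel T) (tree_e : is_tree e)
    (n_gt3 : 3 < #|T|)
    (diam_ge : (2 * #|T|%:R / 3 <= (diam e)%:R :> rat)%R) :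
  wiener e < E1 e.
Proof.
case: tree_e => [[sym_e _] _ conn_e _].
have le_nD : 2 * #|T| <= 3 * diam e.
  by rewrite -(Num.Theory.ler_nat rat) !GRing.natrM; lra.
by apply: wiener_lt_E1 => //; lia.
Qed.
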